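(* Let $a, p, q$ be integers with $p, q > 0$, $a > 1$ and $q < p-1$, and let $\{J_n\}_{n=1}^{\infty}$ be the sequence defined by $J_1 = 1$, $J_2 = a$, and $J_n = pJ_{n-1} - qJ_{n-2}$ for $n > 2$. Then $\{J_n\}_{n=1}^{\infty}$ is totally greedy.
   Context: Let $S = \{s_1 = 1, s_2, \ldots, s_t\}$ be a set of integers (coin denominations) listed with $1 = s_1 < s_2 < \cdots < s_t$. For an integer $k \ge 0$, a payment vector for $k$ is a vector $(a_1, \ldots, a_t)$ of nonnegative integers with $\sum_{i=1}^t a_i s_i = k$; it is optimal if $\sum_{i=1}^t a_i$ is minimal among all payment vectors for $k$. The greedy payment vector for $k$ is obtained by running, for $i = t, t-1, \ldots, 1$: $a_i := \lfloor k/s_i \rfloor$, then replace $k$ by $k \bmod s_i$. The set $S$ is called greedy if for every integer $k \ge 0$ the greedy payment vector for $k$ is optimal. An integer sequence $\{s_n\}_{n=1}^\infty$ with $s_1 = 1$ and $s_i < s_{i+1}$ for all $i$ is called totally greedy if every prefix subset $\{1, s_2, \ldots, s_k\}$ is greedy. *)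

(* Defs.v *)
From mathcomp Require Import all_boot all_order all_algebra.

Set Implicit Arguments.
Unset Strict Implicit.
Unset Printing Implicit Defensive.

Import Order.TTheory GRing.Theory Num.Theory.
Local Open Scope ring_scope.

(* A set {s_1 = 1 < s_2 < ... < s_t} of denominations is given by its
   increasing enumeration, so s_i is S`_(i - 1).  The first conjunct also
   forces S to be nonempty, since [::]`_0 = 0. *)
Definition coin_system (S : seq int) : bool :=
  (S`_0 == 1) && sorted <%R S.

Definition payment_vector (S : seq int) (k : int) (c : seq int) : Prop :=
  [/\ size c = size S,
      forall i, (i < size c)%N -> 0 <= c`_i
    & \sum_(i < size S) c`_i * S`_i = k].

Definition num_coins (c : seq int) : int := \sum_(x <- c) x.

Definition optimal (S : seq int) (k : int) (c : seq int) : Prop :=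
  payment_vector S k c /\
  forall c', payment_vector S k c' -> num_coins c <= num_coins c'.

(* The denominations in D are processed from left to right; for a positive
   denomination s, divz and modz are the floor quotient and its remainder. *)
Fixpoint greedy_rec (D : seq int) (k : int) : seq int :=
  if D is s :: D' then (k %/ s)%Z :: greedy_rec D' (k %% s)%Z else [::].

(* The algorithm runs from the largest denomination down, while payment
   vectors are indexed like S; hence the two reversals. *)
Definition greedy_payment (S : seq int) (k : int) : seq int :=
  rev (greedy_rec (rev S) k).

Definition greedy (S : seq int) : Prop :=
  coin_system S /\ forall k : int, 0 <= k -> optimal S k (greedy_payment S k).

(* Sequences are indexed from 1; the value s 0 is never used. *)
Definition totally_greedy (s : nat -> int) : Prop :=
  [/\ s 1%N = 1,
      forall i, (0 < i)%N -> s i < s i.+1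
    & forall k, (0 < k)%N -> greedy [seq s i | i <- iota 1 k]].

(* Main.v *)
(** Let [g k] be the number of coins in the greedy payment of [k] over a
    system with largest coin [s].  The system is greedy once adding any of its
    coins to an amount raises [g] by at most one.  This property survives the
    addition of a coin [s'] >= [s] as soon as [m * s = s' + q * u] for some coin
    [u] and some [q < m]: then
    [m + g k = g (k + m * s) = g (k + s' + q * u) <= g (k + s') + q],
    so [1 + g k <= g (k + s')], that is, using [s'] whenever it fits never
    hurts.  The recurrence provides such a relation, with [m = p]. *)
Require Import Defs.
From mathcomp Require Import all_boot all_order all_algebra.
From mathcomp Require Import zify.
Import Order.TTheory GRing.Theory Num.Theory.
Local Open Scope ring_scope.

(* Denominations [D] are listed in decreasing order, as in [greedy_rec]. *)
Definition greedy_count (D : seq int) (k : int) : int :=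
  num_coins (greedy_rec D k).

Definition coin_subadditive (D : seq int) : Prop :=
  forall s k : int, s \in D -> 0 <= k ->
  greedy_count D (k + s) <= greedy_count D k + 1.

Lemma greedy_count_cons (s : int) (D : seq int) (k : int) :
  greedy_count (s :: D) k = (k %/ s)%Z + greedy_count D (k %% s)%Z.
Proof. by rewrite /greedy_count /num_coins /= big_cons. Qed.

Lemma greedy_count0 (D : seq int) : greedy_count D 0 = 0.
Proof.
elim: D => [|s D IH]; first by rewrite /greedy_count /num_coins big_nil.
by rewrite greedy_count_cons div0z mod0z IH.
Qed.

Lemma greedy_count_add_top (s : int) (D : seq int) (k m : int) : s != 0 ->
  greedy_count (s :: D) (k + m * s) = greedy_count (s :: D) k + m.
Proof.
move=> s0; rewrite !greedy_count_cons [k + _]addrC modzMDl.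
by rewrite divzDl ?dvdz_mull // mulzK //; lia.
Qed.

Lemma greedy_count_below_top (s : int) (D : seq int) (k : int) :
  0 <= k < s -> greedy_count (s :: D) k = greedy_count D k.
Proof.
move=> kD; rewrite greedy_count_cons modz_small // divz_small ?add0r //.
by lia.
Qed.

Lemma coin_subadditive_mul (D : seq int) (s k m : int) : coin_subadditive D ->
  s \in D -> 0 <= s -> 0 <= k -> 0 <= m ->
  greedy_count D (k + m * s) <= greedy_count D k + m.
Proof.
move=> subD sD s0 k0; case: m => // n _; elim: n => [|n IH].
  by rewrite mul0r !addr0.
have -> : k + n.+1%:Z * s = k + n%:Z * s + s by lia.
apply: le_trans (subD s (k + n%:Z * s) sD _) _; last by lia.
by rewrite addr_ge0 ?mulr_ge0.
Qed.

Lemma coin_subadditive_cons (s s' u m q : int) (D : seq int) :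
  coin_subadditive (s :: D) ->
  {in s :: D, forall t : int, 0 < t <= s} -> s <= s' ->
  u \in s :: D -> 0 <= q < m -> m * s = s' + q * u ->
  coin_subadditive (s' :: s :: D).
Proof.
move=> subD posD ss' uD /andP[q0 qm] rel.
have s_gt0 : 0 < s by case/andP: (posD s (mem_head _ _)).
have s'_gt0 : 0 < s' by apply: lt_le_trans ss'.
have s'n0 : s' != 0 by rewrite gt_eqF.
have u_gt0 : 0 < u by case/andP: (posD u uD).
have use_s' (k : int) : 0 <= k ->
    greedy_count (s :: D) k + 1 <= greedy_count (s :: D) (k + s').
  move=> k0; have := greedy_count_add_top s D k m (lt0r_neq0 s_gt0).
  rewrite rel addrA.
  have ks'0 : 0 <= k + s' by lia.
  have := coin_subadditive_mul (s :: D) u (k + s') q subD uD (ltW u_gt0) ks'0 q0.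
  move=> /[swap] ->.
  by move: (greedy_count _ k) (greedy_count _ (k + s')) => x y; lia.
move=> t k; rewrite inE => /predU1P[-> k0|tD k0].
  by have := greedy_count_add_top s' (s :: D) k 1 s'n0; rewrite mul1r => ->.
have /andP[t0 ts] := posD t tD.
have r0 : 0 <= (k %% s')%Z by rewrite modz_ge0.
have rs' : (k %% s')%Z < s' by rewrite ltz_pmod.
(* The full multiples of [s'] in [k] add the same [x] to both counts and cancel, so only the
   remainder [r < s'] matters. *)
rewrite [k](divz_eq k s'); move: (k %/ s')%Z (k %% s')%Z r0 rs' => x r r0 rs'.
have -> : x * s' + r + t = r + t + x * s' by lia.
rewrite [x * s' + r]addrC !greedy_count_add_top // addrAC lerD2r.
rewrite (greedy_count_below_top s' _ r) ?r0 //.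
apply: le_trans (subD t r tD r0).
(* As [t <= s <= s'], the sum [r + t] stays below [2 * s'], so [s'] is paid at most once. If it is
   paid, [use_s'] at [r + t - s'] shows that the new count of [r + t] does not exceed the old
   one. *)
have [rts'|rts'] := ltP (r + t) s'.
  by rewrite greedy_count_below_top //; lia.
have := greedy_count_add_top s' (s :: D) (r + t - s') 1 s'n0.
rewrite mul1r subrK => ->.
rewrite greedy_count_below_top; last by lia.
by have := use_s' (r + t - s'); rewrite subrK; apply; lia.
Qed.

Lemma size_greedy_rec (D : seq int) (k : int) : size (greedy_rec D k) = size D.
Proof. by elim: D k => //= s D IH k; rewrite IH. Qed.

Lemma greedy_rec_ge0 (D : seq int) (k : int) :
  {in D, forall s : int, 0 < s} -> 0 <= k ->
  {in greedy_rec D k, forall x : int, 0 <= x}.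
Proof.
elim: D k => //= s D IH k posD k0 x.
have s0 : 0 < s by apply: posD; exact: mem_head.
rewrite inE => /predU1P[->|]; first by rewrite divz_ge0.
apply: IH => [t tD|]; last by rewrite modz_ge0 // gt_eqF.
by apply: posD; rewrite inE tD orbT.
Qed.

(** The final coin [1] absorbs whatever remainder is left, so nothing stays unpaid. *)
Lemma greedy_rec_sum (D : seq int) (k : int) :
  \sum_(i < size (rcons D 1)) (greedy_rec (rcons D 1) k)`_i * (rcons D 1)`_i = k.
Proof.
elim: D k => [|s D IH] k /=; first by rewrite big_ord1 /= divz1 mulr1.
by rewrite big_ord_recl /= IH -divz_eq.
Qed.

Lemma num_coins_nth (c : seq int) : num_coins c = \sum_(i < size c) c`_i.
Proof. by rewrite /num_coins (big_nth 0) big_mkord. Qed.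

Lemma greedy_payment_vector (S : seq int) (k : int) : S`_0 = 1 ->
  {in S, forall s : int, 0 < s} -> 0 <= k ->
  payment_vector S k (greedy_payment S k).
Proof.
move=> S0 posS k0; rewrite /greedy_payment.
have sz : size (rev (greedy_rec (rev S) k)) = size S.
  by rewrite size_rev size_greedy_rec size_rev.
split=> // [i ilt|].
  have /mem_nth-/(_ 0) := ilt; rewrite mem_rev; apply: greedy_rec_ge0 => // s.
  by rewrite mem_rev; apply: posS.
(* Splitting off the coin [1] at the head of [S] gives the reversed list the form [rcons _ 1];
   reversing the summation index then undoes both reversals. *)
case: S S0 sz {posS} => //= _ S -> sz.
rewrite rev_cons (reindex_inj rev_ord_inj) /=.
rewrite -[RHS](greedy_rec_sum (rev S) k) size_rcons size_rev.
apply: eq_bigr => i _.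
rewrite nth_rev ?size_greedy_rec ?size_rcons ?size_rev ?subSS ?ltnS ?leq_subr //.
have le_i : (i <= size S)%N by rewrite -ltnS.
by rewrite subKn // -rev_cons nth_rev.
Qed.

(** Building [k] up from [0] with the coins of [c], each coin raises the greedy count by at most
    one. *)
Lemma coin_subadditive_lower_bound (S : seq int) (k : int) (c : seq int) :
  {in S, forall s : int, 0 < s} -> coin_subadditive (rev S) ->
  payment_vector S k c -> greedy_count (rev S) k <= num_coins c.
Proof.
move=> posS subS [szc c0 <-]; rewrite num_coins_nth szc.
(* Quantifying over the starting amount [k0] makes the bound additive: the second summand is applied
   at [k0 + x], which is why [0 <= x] is carried along. *)
pose bounds (x n : int) := 0 <= x /\ forall k0, 0 <= k0 ->
  greedy_count (rev S) (k0 + x) <= greedy_count (rev S) k0 + n.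
suff [_ /(_ 0 (lexx 0))] : bounds (\sum_(i < size S) c`_i * S`_i)
                                  (\sum_(i < size S) c`_i).
  by rewrite greedy_count0 !add0r.
apply: big_ind2 => [|x n y m [x0 bx] [y0 by_]|i _].
- by split=> // k0; rewrite !addr0.
- split=> [|k0 k00]; first by rewrite addr_ge0.
  rewrite addrA; apply: le_trans (by_ _ _) _; first by rewrite addr_ge0.
  by rewrite addrA lerD2r bx.
have iS : S`_i \in S by rewrite mem_nth.
have ci0 : 0 <= c`_i by rewrite c0 ?szc.
have si0 := ltW (posS _ iS).
split=> [|k0 k00]; first by rewrite mulr_ge0.
by apply: coin_subadditive_mul => //; rewrite mem_rev.
Qed.

Lemma coin_subadditive_greedy (S : seq int) :
  coin_system S -> {in S, forall s : int, 0 < s} -> coin_subadditive (rev S) ->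
  greedy S.
Proof.
move=> sysS posS subS; split=> // k k0.
have [/eqP S0 _] := andP sysS.
split=> [|c' pay]; first exact: greedy_payment_vector.
have := coin_subadditive_lower_bound S k c' posS subS pay.
rewrite /greedy_count /greedy_payment /num_coins.
by rewrite (perm_big _ (permEl (perm_rev _))).
Qed.

Lemma rev_prefixS (J : nat -> int) (n : nat) :
  rev [seq J i | i <- iota 1 n.+1] = J n.+1 :: rev [seq J i | i <- iota 1 n].
Proof. by rewrite -[in iota _ n.+1](addn1 n) iotaD map_cat rev_cat. Qed.

Theorem theorem3 (a p q : int) (J : nat -> int)
  (hp : 0 < p) (hq : 0 < q) (ha : 1 < a) (hqp : q < p - 1)
  (hJ1 : J 1%N = 1) (hJ2 : J 2%N = a)
  (hJ : forall n : nat, (2 < n)%N -> J n = p * J (n - 1)%N - q * J (n - 2)%N) :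
  totally_greedy J.
Proof.
have recJ n : J n.+3 = p * J n.+2 - q * J n.+1.
  by rewrite hJ // !subSS !subn0.
have posJ_incr n : 0 < J n.+1 < J n.+2.
  elim: n => [|n /andP[J0 J1]]; first by rewrite hJ1 hJ2.
  (* The increase amounts to [q * J n.+1 < (p - 1) * J n.+2], which follows from [q < p - 1] and
     [0 < J n.+1 < J n.+2]. *)
  by rewrite recJ (lt_trans J0 J1) /=; nia.
have incrJ i : (0 < i)%N -> J i < J i.+1.
  by case: i => // i _; case/andP: (posJ_incr i).
have posJ i : (0 < i)%N -> 0 < J i.
  by case: i => // i _; case/andP: (posJ_incr i).
have lerJ i n : (0 < i <= n)%N -> J i <= J n.
  move=> /andP[i0]; elim: n => [|n IH]; first by case: i i0.
  rewrite leq_eqVlt => /predU1P[->//|/[!ltnS] le_in].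
  by apply: le_trans (IH le_in) (ltW (incrJ n (leq_trans i0 le_in))).
have subJ n : coin_subadditive (rev [seq J i | i <- iota 1 n.+1]).
  elim: n => [|n IH].
    move=> s k; rewrite rev_prefixS inE => /eqP-> _.
    by have := greedy_count_add_top (J 1%N) [::] k 1; rewrite hJ1 mul1r => ->.
  have bounds : {in rev [seq J i | i <- iota 1 n.+1],
      forall t : int, 0 < t <= J n.+1}.
    move=> t; rewrite mem_rev => /mapP[i]; rewrite mem_iota add1n ltnS => ir ->.
    by rewrite lerJ // posJ //; case/andP: ir.
  have memJ i : (0 < i <= n.+1)%N -> J i \in rev [seq J j | j <- iota 1 n.+1].
    by move=> ir; rewrite mem_rev map_f // mem_iota add1n ltnS.
  rewrite rev_prefixS rev_prefixS.
  rewrite rev_prefixS in IH bounds memJ.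
  have le_top := ltW (incrJ n.+1 isT).
  (* The recurrence does not reach the second coin; there the relation is [a * 1 = a + 0 * 1], with
     [m = a] and [q = 0]. *)
  case: n => [|n] in IH bounds memJ le_top *.
    apply: (coin_subadditive_cons _ _ (J 1%N) a 0) => //; first exact: memJ.
      by lia.
    by rewrite hJ1 hJ2 mulr1 mul0r addr0.
  (* Here the relation is the recurrence rearranged: [p * J n.+2 = J n.+3 + q * J n.+1]. *)
  apply: (coin_subadditive_cons _ _ (J n.+1) p q) => //.
  - by apply: memJ; rewrite /= ltnW.
  - by lia.
  - by rewrite recJ subrK.
split=> // -[//|n] _; apply: coin_subadditive_greedy => //.
- apply/andP; split; first by rewrite /= hJ1.
  apply/(sortedP 0) => i; rewrite size_map size_iota => ilt.
  by rewrite !(nth_map 0%N) ?size_iota ?nth_iota ?(ltnW ilt) // addnS; apply: incrJ.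
- by move=> s /mapP[i]; rewrite mem_iota => /andP[i0 _] ->; apply: posJ.
Qed.
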